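(* Let $\Theta$ and $\mathcal{Z}$ be measurable spaces, let $S$ be a random element of $\mathcal{Z}$, and let $\Delta:\Theta\times\mathcal{Z}\to\mathbb{R}$ and $V:\Theta\times\mathcal{Z}\to[0,\infty)$ be measurable maps such that, writing $\Delta_\vartheta=\Delta(\vartheta,S)$ and $V_\vartheta=V(\vartheta,S)$, the pair $(\Delta_\vartheta,\sqrt{V_\vartheta})$ is a canonical pair for every fixed $\vartheta\in\Theta$. Let $\hat p$ be a probability kernel from $\mathcal{Z}$ to $\Theta$, $p^0$ a probability measure on $\Theta$, and let $\theta$ be a random element of $\Theta$ whose conditional distribution given $S$ is $\hat p_S$. Assume $\int|\Delta(\vartheta,S)|\,\hat p_S(d\vartheta)<\infty$ almost surely. Then: (i) if $0<\mathbb{E}[V_\theta]<\infty$, then for every $x\ge 0$, with probability at least $1-2e^{-x}$, \[ |\mathbb{E}[\Delta_\theta\mid S]|\le \sqrt{2\big(\mathbb{E}[V_\theta]+\mathbb{E}[V_\theta\mid S]\big)\big(\mathrm{KL}(\hat p_S\,\|\,p^0)+2x\big)}; \] (ii) for every $y>0$ and every $x\ge 2$, with probability at least $1-e^{-x}$, \[ |\mathbb{E}[\Delta_\theta\mid S]|\le \sqrt{2\big(y+\mathbb{E}[V_\theta\mid S]\big)\Big(\mathrm{KL}(\hat p_S\,\|\,p^0)+x+\frac{x}{2}\ln\Big(1+\frac{1}{y}\mathbb{E}[V_\theta\mid S]\Big)\Big)}. \]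
   Context: A pair $(A,B)$ of real random variables is a canonical pair if $B\ge0$ and $\sup_{\lambda\in\mathbb{R}}\mathbb{E}[\exp(\lambda A-\lambda^2B^2/2)]\le1$. A probability kernel $\hat p$ from $\mathcal{Z}$ to $\Theta$ assigns to each $z\in\mathcal{Z}$ a probability measure $\hat p_z$ on $\Theta$, measurably in $z$. Notation: $\mathbb{E}[\Delta_\theta\mid S]=\int\Delta(\vartheta,S)\,\hat p_S(d\vartheta)$, $\mathbb{E}[V_\theta\mid S]=\int V(\vartheta,S)\,\hat p_S(d\vartheta)$, and $\mathbb{E}[V_\theta]=\mathbb{E}\big[\mathbb{E}[V_\theta\mid S]\big]$. $\mathrm{KL}(p\,\|\,q)=\int\ln\frac{dp}{dq}\,dp$ if $p\ll q$ and $+\infty$ otherwise (in which case the bounds are trivial). *)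

(* Defs.v *)
From HB Require Import structures.
From mathcomp Require Import all_boot all_order all_algebra.
From mathcomp Require Import all_classical all_reals all_analysis.
Set Implicit Arguments. Unset Strict Implicit. Unset Printing Implicit Defensive.
Import Order.TTheory GRing.Theory Num.Theory.
Local Open Scope classical_set_scope.
Local Open Scope ring_scope.
Local Open Scope ereal_scope.

Section defs.
Context (R : realType).

Definition canonical_pair d (Omega : measurableType d) (P : probability Omega R)
  (A B : Omega -> R) : Prop :=
  (forall w, (0 <= B w)%R) /\
  ereal_sup [set \int[P]_w (expR (lam * A w - lam ^+ 2 * (B w) ^+ 2 / 2))%:E
            | lam in [set: R]] <= 1.

Definition is_density d (T : measurableType d) (p q : {measure set T -> \bar R})
  (f : T -> R) : Prop :=
  [/\ measurable_fun [set: T] f, (forall t, (0 <= f t)%R) &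
      forall A, measurable A -> p A = \int[q]_(t in A) (f t)%:E].

Definition KL d (T : measurableType d) (p q : {measure set T -> \bar R}) : \bar R :=
  if pselect (p `<< q) is left _ then
    \int[p]_t (ln (xget (fun _ => 0%R) [set f | is_density p q f] t))%:E
  else +oo.

Definition eln (e : \bar R) : \bar R :=
  match e with
  | r%:E => (ln r)%:E
  | +oo => +oo
  | -oo => -oo
  end.

(** E[f_theta | S = z] = int f(t, z) phat_z(dt) *)
Definition cexpk d d' (Th : measurableType d) (Z : measurableType d')
  (phat : R.-pker Z ~> Th) (f : Th * Z -> R) (z : Z) : \bar R :=
  \int[phat z]_t (f (t, z))%:E.

End defs.

(* Main.v *)
(** Averaging [exp (l * A - l^2 * V / 2)] over [l ~ N(0, 1/y)] gives
    [exp (A^2 / (2 (y + V)) - ln (1 + V / y) / 2)], whose mean is therefore at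
    most 1 for a canonical pair [(A, sqrt V)], and by Tonelli also after a
    further average over [p0]. The Donsker-Varadhan inequality transfers this
    to the posterior: the posterior mean of [Delta^2 / (2 (y + V))] is at most
    [KL + ln G + ln (1 + E[V | S] / y) / 2], where [G] is the [p0]-average and
    Jensen's inequality was used for [ln]. By Cauchy-Schwarz, [|E[Delta | S]|^2]
    is at most [2 (y + E[V | S])] times that mean. For (ii), Markov's inequality
    gives [G < e^x]. For (i), take [y = E[V]] and [u = E[V | S] / y]; then
    [G + 1 + u] has mean at most 3, and [G + 1 + u < 2 e^x] implies
    [G (1 + u) <= e^(2x)] by AM-GM. *)
Require Import Defs.
From HB Require Import structures.
From mathcomp Require Import all_boot all_order all_algebra.
From mathcomp Require Import all_classical all_reals all_analysis.
From mathcomp Require Import measurable_realfun ring lra.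
Set Implicit Arguments.
Unset Strict Implicit.
Unset Printing Implicit Defensive.
Import Order.TTheory GRing.Theory Num.Theory.
Local Open Scope classical_set_scope.
Local Open Scope ring_scope.
Local Open Scope ereal_scope.

(** * Densities and the Donsker-Varadhan inequality *)

Lemma measurable_funV_ge0 d (T : measurableType d) (R : realType) (f : T -> R) :
  (forall t, 0 <= f t)%R -> measurable_fun [set: T] f ->
  measurable_fun [set: T] (fun t => (f t)^-1)%R.
Proof.
(* On nonnegative reals, 0 included, inversion is the power -1. *)
move=> f0 mf; under eq_fun do rewrite -powR_inv1//.
exact: (measurableT_comp (measurable_powR (- 1)%R) mf).
Qed.

(** The extended-valued Radon-Nikodym derivative is finite everywhere, so [fine] turns it into a
    real-valued density. Hence the [xget] inside [KL] picks a genuine density and never its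
    default. *)
Lemma ex_density d (T : measurableType d) (R : realType)
    (p : {finite_measure set T -> \bar R})
    (q : {sigma_finite_measure set T -> \bar R}) :
  p `<< q -> exists g, is_density p q g.
Proof.
move=> pq; pose f := Radon_Nikodym_SigmaFinite.f p q.
have fE t : (fine (f t))%:E = f t.
  by rewrite fineK// Radon_Nikodym_SigmaFinite.f_fin_num.
exists (fun t => fine (f t)); split.
- apply: measurableT_comp; first exact: fine_measurable.
  exact: measurable_int (Radon_Nikodym_SigmaFinite.f_integrable pq).
- by move=> t; rewrite fine_ge0// Radon_Nikodym_SigmaFinite.f_ge0.
- move=> A mA; apply: etrans (Radon_Nikodym_SigmaFinite.f_integral pq mA) _.
  by apply: eq_integral => t _; rewrite fE.
Qed.

(** Change of variables holds for the Radon-Nikodym derivative, and [g] agrees with it [q]-almost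
    everywhere because both have the same integral over every measurable set. *)
Lemma density_integral d (T : measurableType d) (R : realType)
    (p : {finite_measure set T -> \bar R})
    (q : {sigma_finite_measure set T -> \bar R}) (g : T -> R) (h : T -> \bar R) :
  is_density p q g -> measurable_fun [set: T] h -> (forall t, 0 <= h t) ->
  \int[p]_t h t = \int[q]_t (h t * (g t)%:E).
Proof.
move=> [mg g0 gE] mh h0.
have pq : p `<< q.
  apply/null_content_dominatesP => A mA qA0; rewrite gE// null_set_integral//.
  exact/measurable_EFinP/measurable_funTS.
have fint := Radon_Nikodym_SigmaFinite.f_integrable pq.
rewrite -(Radon_Nikodym_SigmaFinite.change_of_variables pq)//.
apply: ae_eq_integral => //.
- by apply: emeasurable_funM => //; exact: measurable_int fint.
- by apply: emeasurable_funM => //; exact/measurable_EFinP.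
- apply: ae_eqe_mul2l; apply: integral_ae_eq => //.
  + exact/measurable_EFinP.
  + move=> A _ mA.
    by apply: etrans (esym (Radon_Nikodym_SigmaFinite.f_integral pq mA)) (gE _ mA).
Qed.

(* Writing [g] for the density, integrate with respect to [p] the inequality
   [a - b - ln g + 1 <= exp (a - b) / g], after moving negative terms across so
   that no integrability of [ln g] or [b] is required. *)
Lemma donsker_varadhan d (T : measurableType d) (R : realType)
    (p q : probability T R) (a b : T -> R) :
  measurable_fun [set: T] a -> measurable_fun [set: T] b ->
  (forall t, 0 <= a t)%R -> (forall t, 0 <= b t)%R ->
  \int[q]_t (expR (a t - b t))%:E <= 1 ->
  \int[p]_t (a t)%:E <= KL p q + \int[p]_t (b t)%:E.
Proof.
move=> ma mb a0 b0 ab1; rewrite /KL; case: pselect => [pq|_]; last first.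
  have b_ge0 : 0 <= \int[p]_t (b t)%:E.
    by apply: integral_ge0 => t _; rewrite lee_fin.
  by rewrite addye ?leey// gt_eqF// (lt_le_trans _ b_ge0).
have /= := xgetPex (fun=> 0%R) (ex_density pq).
set g := xget _ _ => dg; have [mg g0 gE] := dg.
have mgV : measurable_fun [set: T] (fun t => (g t)^-1)%R.
  exact: measurable_funV_ge0.
have mL : measurable_fun [set: T] (fun t => (ln (g t))%:E).
  by apply/measurable_EFinP; exact: measurableT_comp.
pose L := fun t => (ln (g t))%:E.
(* Passing to [q] multiplies by [g], which cancels the inverse except where [g] vanishes; there the
   integrand becomes 0, so only an inequality remains. *)
have gV1 (h : T -> R) : measurable_fun [set: T] h -> (forall t, 0 <= h t)%R ->
    \int[q]_t (h t)%:E <= 1 -> \int[p]_t (h t * (g t)^-1)%:E <= 1.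
  move=> mh h0 h1; rewrite (density_integral dg); last 2 first.
  - by apply/measurable_EFinP; exact: measurable_funM.
  - by move=> t; rewrite lee_fin mulr_ge0// invr_ge0.
  apply: le_trans h1; apply: ge0_le_integral => //.
  - by move=> t _; rewrite -EFinM lee_fin !mulr_ge0// invr_ge0.
  - apply/measurable_EFinP; apply: measurable_funM => //.
    exact: measurable_funM.
  - exact/measurable_EFinP.
  - move=> t _; rewrite -EFinM lee_fin -mulrA.
    by have [->|gt0] := eqVneq (g t) 0%R; rewrite ?mulr0// mulVf// mulr1.
(* The zero set of [g] has [p]-measure equal to the [q]-integral of 0. *)
have g_gt0 : {ae p, forall t, (0 < g t)%R}.
  have mN : measurable (g @^-1` [set 0%R]).
    by rewrite -[X in measurable X]setTI; exact: mg.
  exists (g @^-1` [set 0%R]); split => //.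
    by rewrite gE//; apply: integral0_eq => t /= ->.
  by move=> t /= /negP; rewrite lt_def g0 andbT negbK => /eqP.
have mLp := measurable_funepos mL; have mLn := measurable_funeneg mL.
(* The negative part of [ln g] is below [1 / g], because [ln (1 / g) < 1 / g]. *)
have Ln1 : \int[p]_t L^\- t <= 1.
  apply: le_trans (gV1 (cst 1%R) _ _ _) => //; last first.
    by rewrite [leLHS](integral_cst q measurableT 1) mul1e; exact: probability_le1.
  apply: ae_ge0_le_integral => //.
  - by move=> t _; rewrite lee_fin mulr_ge0// invr_ge0.
  - by apply/measurable_EFinP; exact: measurable_funM.
  - apply: filterS g_gt0 => t gt0 _ /=.
    rewrite funenegE -EFin_max lee_fin ge_max mul1r invr_ge0 g0 andbT.
    rewrite -lnV ?posrE// ltW// ln_sublinear// invr_gt0//.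
pose h := fun t => (expR (a t - b t) * (g t)^-1)%:E.
have mab : measurable_fun [set: T] (fun t => expR (a t - b t)).
  by apply: measurableT_comp => //; exact: measurable_funB.
have h1 : \int[p]_t h t <= 1 by apply: gV1 => // t; exact: expR_ge0.
have mh : measurable_fun [set: T] h.
  by apply/measurable_EFinP; exact: measurable_funM.
have h0 t : 0 <= h t by rewrite lee_fin mulr_ge0// ?expR_ge0// invr_ge0.
have maE : measurable_fun [set: T] (EFin \o a) by exact/measurable_EFinP.
have mbE : measurable_fun [set: T] (EFin \o b) by exact/measurable_EFinP.
have le_int : \int[p]_t ((a t)%:E + 1 + L^\- t) <=
    \int[p]_t (L^\+ t + (b t)%:E + h t).
  apply: ae_ge0_le_integral => //.
  - by move=> t _; rewrite !adde_ge0// lee_fin.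
  - by apply: emeasurable_funD => //; exact: emeasurable_funD.
  - by move=> t _; rewrite !adde_ge0// lee_fin.
  - by apply: emeasurable_funD => //; exact: emeasurable_funD.
  (* This is [1 + z <= exp z] at [z = a - b - ln g], with [ln g] split into its positive and
     negative parts. *)
  apply: filterS g_gt0 => t gt0 _; rewrite funenegE funeposE /L /h.
  rewrite -!EFin_max -!EFinD lee_fin.
  have <- : expR (a t - b t - ln (g t)) = (expR (a t - b t) * (g t)^-1)%R.
    by rewrite expRB (lnK gt0).
  have := expR_ge1Dx (a t - b t - ln (g t)).
  case: (leP (ln (g t)) 0%R) => l0.
    by rewrite (max_idPl _) ?oppr_ge0//; lra.
  by rewrite (max_idPr _) ?oppr_le0 ?(ltW l0)//; lra.
(* Finiteness allows this integral to be subtracted again, which recovers the integral of [ln g]. *)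
have Nfin : \int[p]_t L^\- t \is a fin_num.
  rewrite ge0_fin_numE; last exact: integral_ge0.
  by rewrite (le_lt_trans Ln1)// ltry.
move: le_int.
have mpos : measurable_fun [set: T] (fun t => L^\+ t + (b t)%:E).
  exact: emeasurable_funD.
have mneg : measurable_fun [set: T] (fun t => (a t)%:E + 1).
  exact: emeasurable_funD.
rewrite ge0_integralD//; last by move=> t _; rewrite adde_ge0// lee_fin.
rewrite ge0_integralD//; last by move=> t _; rewrite lee_fin.
rewrite ge0_integralD//; last by move=> t _; rewrite adde_ge0// lee_fin.
rewrite ge0_integralD//; last by move=> t _; rewrite lee_fin.
have -> : \int[p]__ 1 = 1.
  apply: etrans (integral_cst p measurableT 1) _.
  by rewrite mul1e; exact: probability_setT.
(* The bound 1 on the integral of [h] cancels the 1 on the left. *)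
move=> /le_trans/(_ (leeD2l _ h1)); rewrite [X in _ -> _ <= X + _]integralE.
move: Nfin; case: (\int[p]_t L^\- t) => // n _.
case: (\int[p]_t (a t)%:E) => [x| |]; case: (\int[p]_t L^\+ t) => [y| |];
  case: (\int[p]_t (b t)%:E) => [z| |] //=;
  rewrite -?EFinD ?addey ?addye ?leey ?leNye//.
by rewrite !lee_fin; lra.
Qed.

Lemma KL_ge0 d (T : measurableType d) (R : realType) (p q : probability T R) :
  0 <= KL p q.
Proof.
have := @donsker_varadhan _ _ _ p q (cst 0%R) (cst 0%R).
rewrite integral0 adde0; apply=> //.
under eq_integral do rewrite subrr expR0.
by rewrite [leLHS](integral_cst q measurableT 1) mul1e; exact: probability_le1.
Qed.

(** * Gaussian mixtures of exponential moments *)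

(* [gain y a v - cost y v] is the logarithm of the mean of
   [exp (l * a - l^2 * v / 2)] for [l ~ N(0, 1/y)]. *)
Definition gain (R : realType) (y a v : R) : R := (a ^+ 2 / (2 * (y + v)))%R.

Definition cost (R : realType) (y v : R) : R := (ln (1 + v / y) / 2)%R.

Lemma gain_ge0 (R : realType) (y a v : R) :
  (0 < y)%R -> (0 <= v)%R -> (0 <= gain y a v)%R.
Proof. by move=> y0 v0; rewrite divr_ge0 ?sqr_ge0// mulr_ge0// addr_ge0// ltW. Qed.

Lemma cost_ge0 (R : realType) (y v : R) :
  (0 < y)%R -> (0 <= v)%R -> (0 <= cost y v)%R.
Proof.
by move=> y0 v0; rewrite divr_ge0// ln_ge0// lerDl divr_ge0// ltW.
Qed.

Lemma measurable_gain d (T : measurableType d) (R : realType) (y : R)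
    (A V : T -> R) : (0 < y)%R -> (forall t, 0 <= V t)%R ->
  measurable_fun [set: T] A -> measurable_fun [set: T] V ->
  measurable_fun [set: T] (fun t => gain y (A t) (V t)).
Proof.
move=> y0 V0 mA mV; apply: measurable_funM; first exact: measurable_funX.
apply: measurable_funV_ge0 => [t|]; first by rewrite mulr_ge0// addr_ge0// ltW.
by apply: measurable_funM => //; exact: measurable_funD.
Qed.

Lemma measurable_cost d (T : measurableType d) (R : realType) (y : R)
    (V : T -> R) : measurable_fun [set: T] V ->
  measurable_fun [set: T] (fun t => cost y (V t)).
Proof.
move=> mV; apply: measurable_funM => //.
apply: measurableT_comp; first exact: measurable_ln.
by apply: measurable_funD => //; exact: measurable_funM.
Qed.

Lemma expR_half_ln (R : realType) (u : R) : (0 < u)%R ->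
  expR (ln u / 2) = Num.sqrt u.
Proof.
move=> u0; rewrite -powR12_sqrt ?ltW// /powR gt_eqF//.
by rewrite mulrC.
Qed.

(** Complete the square in [l]: the tilted density is again Gaussian, with precision [y + v] and
    mean [a / (y + v)]. The remainder of the exponent is [gain], and the ratio [sqrt (y / (y + v))]
    of the normalizing constants is [exp (- cost)]. *)
Lemma normal_pdf_tilt (R : realType) (y a v l : R) : (0 < y)%R -> (0 <= v)%R ->
  (expR (l * a - l ^+ 2 * v / 2) * normal_pdf 0 (Num.sqrt y)^-1 l =
   expR (gain y a v - cost y v) *
     normal_pdf (a / (y + v)) (Num.sqrt (y + v))^-1 l)%R.
Proof.
move=> y0 v0; have yv0 : (0 < y + v)%R by rewrite ltr_pwDl.
have s0 (z : R) : (0 < z -> (Num.sqrt z)^-1 != 0)%R.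
  by move=> z0; rewrite invr_eq0 gt_eqF// sqrtr_gt0.
rewrite !normal_pdfE ?s0// /normal_fun /normal_peak !exprVn !sqr_sqrtr ?ltW//.
rewrite [expR (gain _ _ _ - _)]expRB (_ : cost y v = ln ((y + v) / y) / 2)%R; last first.
  by rewrite /cost mulrDl divff// gt_eqF.
rewrite expR_half_ln ?divr_gt0//.
have -> : (Num.sqrt (y^-1 * pi *+ 2) =
    Num.sqrt ((y + v) / y) * Num.sqrt ((y + v)^-1 * pi *+ 2))%R.
  rewrite -sqrtrM ?divr_ge0 ?ltW//; congr Num.sqrt.
  by field; rewrite !gt_eqF.
rewrite invfM.
have -> : (expR (l * a - l ^+ 2 * v / 2) * ((Num.sqrt ((y + v) / y))^-1 *
    (Num.sqrt ((y + v)^-1 * pi *+ 2))^-1 * expR (- (l - 0) ^+ 2 / (y^-1 *+ 2)))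
  = (Num.sqrt ((y + v) / y))^-1 * (Num.sqrt ((y + v)^-1 * pi *+ 2))^-1 *
   expR (l * a - l ^+ 2 * v / 2 + (- (l - 0) ^+ 2 / (y^-1 *+ 2))))%R.
  by rewrite [expR (l * a - _ + _)]expRD; ring.
have -> : (l * a - l ^+ 2 * v / 2 + (- (l - 0) ^+ 2 / (y^-1 *+ 2)) =
  gain y a v + - (l - a / (y + v)) ^+ 2 / ((y + v)^-1 *+ 2))%R.
  by rewrite /gain; field; rewrite !gt_eqF.
by rewrite [expR (gain _ _ _ + _)]expRD; ring.
Qed.

Lemma gaussian_mixture d (T : measurableType d) (R : realType)
    (P : probability T R) (y : R) (A V : T -> R) :
  (0 < y)%R -> (forall t, 0 <= V t)%R ->
  measurable_fun [set: T] A -> measurable_fun [set: T] V ->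
  (forall l : R, \int[P]_t (expR (l * A t - l ^+ 2 * V t / 2))%:E <= 1) ->
  \int[P]_t (expR (gain y (A t) (V t) - cost y (V t)))%:E <= 1.
Proof.
move=> y0 V0 mA mV AV1.
pose f (u : T * R) := (expR (u.2 * A u.1 - u.2 ^+ 2 * V u.1 / 2))%R.
pose phi := normal_pdf 0 (Num.sqrt y)^-1.
have mf : measurable_fun [set: T * R] f.
  apply: measurableT_comp => //; apply: measurable_funB.
    by apply: measurable_funM => //; exact: measurableT_comp.
  apply: measurable_funM => //; apply: measurable_funM => //.
    exact: measurable_funX.
  exact: measurableT_comp.
have mphi : measurable_fun [set: R] phi by exact: measurable_normal_pdf.
have mF : measurable_fun [set: T * R] (fun u => (f u * phi u.2)%:E).
  apply/measurable_EFinP; apply: measurable_funM => //.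
  exact: measurableT_comp.
have F0 u : 0 <= (f u * phi u.2)%:E.
  by rewrite lee_fin mulr_ge0 ?expR_ge0 ?normal_pdf_ge0.
have -> : \int[P]_t (expR (gain y (A t) (V t) - cost y (V t)))%:E =
    \int[P]_t \int[lebesgue_measure]_l (f (t, l) * phi l)%:E.
  apply: eq_integral => t _.
  (* For fixed [t] the tilted normal density has mass 1, so only the constant factor survives. *)
  transitivity (\int[lebesgue_measure]_l
      ((expR (gain y (A t) (V t) - cost y (V t)))%:E *
       (normal_pdf (A t / (y + V t)) (Num.sqrt (y + V t))^-1 l)%:E)).
    rewrite ge0_integralZl//.
    - by rewrite integral_normal_pdf mule1.
    - by apply/measurable_EFinP; exact: measurable_normal_pdf.
    - by move=> l _; exact: normal_pdf_ge0.
  by apply: eq_integral => l _; rewrite -EFinM -normal_pdf_tilt.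
have -> : \int[P]_t \int[lebesgue_measure]_l (f (t, l) * phi l)%:E =
    \int[lebesgue_measure]_l \int[P]_t (f (t, l) * phi l)%:E.
  exact: (@fubini_tonelli _ _ _ _ _ P (@lebesgue_measure R) _ mF F0).
(* Writing 1 as the mass of the mixing density reduces the claim to one inequality for each [l]. *)
rewrite -[leRHS](@integral_normal_pdf R 0 (Num.sqrt y)^-1).
apply: ge0_le_integral => //.
- by move=> l _; apply: integral_ge0 => t _; exact: F0.
- exact: (@measurable_fun_fubini_tonelli_G _ _ _ _ _ P _ mF F0).
- exact/measurable_EFinP.
- move=> l _.
  have -> : \int[P]_t (f (t, l) * phi l)%:E =
      \int[P]_t ((phi l)%:E * (f (t, l))%:E).
    by apply: eq_integral => t _; rewrite EFinM muleC.
  rewrite ge0_integralZl//.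
  + rewrite -[leRHS]mule1 lee_wpmul2l ?lee_fin ?normal_pdf_ge0//.
    exact: AV1.
  + apply/measurable_EFinP.
    exact: (measurableT_comp mf (measurable_pair2 _)).
  + by move=> t _; rewrite lee_fin expR_ge0.
  + by rewrite lee_fin normal_pdf_ge0.
Qed.

(** * A deterministic bound for a single posterior *)

Lemma integral_affine d (T : measurableType d) (R : realType)
    (p : probability T R) (f : T -> R) (c k : R) :
  measurable_fun [set: T] f -> (forall t, 0 <= f t)%R ->
  (0 <= c)%R -> (0 <= k)%R ->
  \int[p]_t (c + k * f t)%:E = c%:E + k%:E * \int[p]_t (f t)%:E.
Proof.
move=> mf f0 c0 k0.
have mfE : measurable_fun [set: T] (EFin \o f) by exact/measurable_EFinP.
under eq_integral do rewrite EFinD EFinM.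
rewrite ge0_integralD//.
- rewrite ge0_integralZl//; last by move=> t _; rewrite lee_fin.
  congr (_ + _); apply: etrans (integral_cst p measurableT c%:E) _.
  by rewrite -[RHS]mule1; congr (_ * _); exact: probability_setT.
- by move=> t _; rewrite -EFinM lee_fin mulr_ge0.
- exact: measurable_funeM.
Qed.

(** Integrate the bound of [ln] by its tangent at [u = 1 + W / y], namely
    [ln r <= ln u + r / u - 1], halved. *)
Lemma jensen_cost d (T : measurableType d) (R : realType)
    (p : probability T R) (V : T -> R) (y W : R) :
  (0 < y)%R -> (forall t, 0 <= V t)%R -> measurable_fun [set: T] V ->
  \int[p]_t (V t)%:E = W%:E -> \int[p]_t (cost y (V t))%:E <= (cost y W)%:E.
Proof.
move=> y0 V0 mV VW.
have W0 : (0 <= W)%R.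
  by rewrite -lee_fin -VW integral_ge0// => t _; rewrite lee_fin.
pose u := (1 + W / y)%R.
have u0 : (0 < u)%R by rewrite ltr_pwDl// divr_ge0// ltW.
have u1 : (1 <= u)%R by rewrite lerDl divr_ge0// ltW.
pose k := (2 * y * u)^-1%R.
have k0 : (0 <= k)%R by rewrite invr_ge0 !mulr_ge0// ltW.
pose c := (cost y W + (2 * u)^-1)%R.
have c0 : (0 <= c)%R by rewrite addr_ge0 ?cost_ge0// invr_ge0 mulr_ge0// ltW.
have hi : (1 / 2 <= 1 :> R)%R by lra.
(* The shift by 1/2 makes the constant term [c] of the tangent nonnegative, as [integral_affine]
   requires. *)
rewrite -(@leeD2lE _ (1 / 2)%:E)// -[X in _ + X]mul1e.
rewrite -(@integral_affine _ _ _ p (fun t => cost y (V t)) (1 / 2) 1)//; first last.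
- by move=> t; exact: cost_ge0.
- exact: measurable_cost.
have -> : (1 / 2)%:E + (cost y W)%:E = \int[p]_t (c + k * V t)%:E.
  rewrite integral_affine// VW -EFinM -!EFinD; congr EFin.
  rewrite /c /k /u; field.
  by rewrite !gt_eqF// ltr_pwDl.
apply: ge0_le_integral => //.
- by move=> t _; rewrite lee_fin addr_ge0// mul1r cost_ge0.
- apply/measurable_EFinP; apply: measurable_funD => //.
  by apply: measurable_funM => //; exact: measurable_cost.
- by apply/measurable_EFinP; apply: measurable_funD => //; exact: measurable_funM.
- move=> t _; rewrite lee_fin mul1r /c /cost -/u.
  have v0 : (0 < 1 + V t / y)%R by rewrite ltr_pwDl// divr_ge0// ltW.
  have := expR_ge1Dx (ln ((1 + V t / y) / u)).
  rewrite lnK ?posrE ?divr_gt0// ln_div ?posrE//.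
  have -> : (k * V t = (1 + V t / y) / u / 2 - (2 * u)^-1)%R.
    by rewrite /k; field; rewrite !gt_eqF.
  by lra.
Qed.

(** AM-GM: the difference of the two sides is a square over a positive number. Integrating this and
    then optimizing [s] plays the part of the Cauchy-Schwarz inequality. *)
Lemma abs_le_gain (R : realType) (y a v s : R) :
  (0 < y)%R -> (0 <= v)%R -> (0 < s)%R ->
  (`|a| <= s * gain y a v + (y / (2 * s) + (2 * s)^-1 * v))%R.
Proof.
move=> y0 v0 s0; have u0 : (0 < y + v)%R by rewrite ltr_pwDl.
rewrite -subr_ge0 (_ : _ - _ = (s * `|a| - (y + v)) ^+ 2 / (2 * s * (y + v)))%R.
  by rewrite divr_ge0 ?sqr_ge0// !mulr_ge0// ltW.
rewrite /gain -(real_normK (num_real a)); field.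
by rewrite !gt_eqF.
Qed.

(** The difference [c1 - c2] bounds the logarithm of the prior average. It is kept as two
    nonnegative constants so that both functions given to [donsker_varadhan] stay nonnegative. *)
Lemma pac_bayes_finite d (T : measurableType d) (R : realType)
    (p q : probability T R) (D V : T -> R) (y c1 c2 k W : R) :
  (0 < y)%R -> (forall t, 0 <= V t)%R ->
  measurable_fun [set: T] D -> measurable_fun [set: T] V ->
  (0 <= c1)%R -> (0 <= c2)%R ->
  (expR c2)%:E * \int[q]_t (expR (gain y (D t) (V t) - cost y (V t)))%:E
    <= (expR c1)%:E ->
  \int[p]_t (V t)%:E = W%:E -> (0 < k)%R ->
  KL p q + (cost y W + c1)%:E <= (k + c2)%:E ->
  `| \int[p]_t (D t)%:E | <= (Num.sqrt (2 * (y + W) * k))%:E.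
Proof.
move=> y0 V0 mD mV c10 c20 q1 VW k0 KLk.
have W0 : (0 <= W)%R.
  by rewrite -lee_fin -VW integral_ge0// => t _; rewrite lee_fin.
have mgain : measurable_fun [set: T] (fun t => gain y (D t) (V t)).
  exact: measurable_gain.
have mcost : measurable_fun [set: T] (fun t => cost y (V t)).
  exact: measurable_cost.
have gain0 t : (0 <= gain y (D t) (V t))%R by exact: gain_ge0.
have cost0 t : (0 <= cost y (V t))%R by exact: cost_ge0.
have gain_k : \int[p]_t (gain y (D t) (V t))%:E <= k%:E.
  (* For these functions the exponential moment is [exp (c2 - c1)] times the prior average, hence at
     most 1. *)
  have := @donsker_varadhan _ _ _ p q (fun t => c2 + 1 * gain y (D t) (V t))%R
    (fun t => c1 + 1 * cost y (V t))%R.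
  rewrite (integral_affine p mgain gain0 c20 ler01).
  rewrite (integral_affine p mcost cost0 c10 ler01) !mul1e => DV.
  have {}DV : c2%:E + \int[p]_t (gain y (D t) (V t))%:E <=
      KL p q + (c1%:E + \int[p]_t (cost y (V t))%:E).
    apply: DV.
    - by apply: measurable_funD => //; exact: measurable_funM.
    - by apply: measurable_funD => //; exact: measurable_funM.
    - by move=> t; rewrite addr_ge0// mul1r.
    - by move=> t; rewrite addr_ge0// mul1r.
    under eq_integral => t _.
      rewrite (_ : expR _ = expR c2 / expR c1 *
        expR (gain y (D t) (V t) - cost y (V t)))%R; last first.
        by rewrite -expRB -expRD; congr expR; ring.
      rewrite EFinM; over.
    rewrite ge0_integralZl//.
    - rewrite mulrC EFinM -muleA -[leRHS](_ : (expR c1)^-1%:E * (expR c1)%:E = 1).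
        by rewrite lee_wpmul2l// lee_fin invr_ge0 expR_ge0.
      by rewrite -EFinM mulVf// gt_eqF// expR_gt0.
    - apply/measurable_EFinP; apply: measurableT_comp => //.
      exact: measurable_funB.
  rewrite -(@leeD2lE _ c2%:E)// (le_trans DV)// [in leRHS]addeC -EFinD.
  apply: le_trans KLk; apply: leeD2l; rewrite [(cost y W + c1)%R]addrC EFinD; apply: leeD2l.
  exact: jensen_cost.
have m0 : (0 < y + W)%R by rewrite ltr_pwDl.
set r := Num.sqrt _.
have r0 : (0 < r)%R by rewrite sqrtr_gt0 !mulr_gt0.
have rr : (r ^+ 2 = 2 * (y + W) * k)%R by rewrite sqr_sqrtr// ltW// !mulr_gt0.
(* This [s] minimizes [s * k + (y + W) / (2 * s)]; both terms then equal [r / 2]. *)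
pose s := (r / (2 * k))%R.
have s0 : (0 < s)%R by rewrite divr_gt0// mulr_gt0.
have mDE : measurable_fun [set: T] (EFin \o D) by exact/measurable_EFinP.
apply: (le_trans (le_abse_integral _ measurableT mDE)).
have cs : (0 <= y / (2 * s))%R by rewrite ltW// divr_gt0// mulr_gt0.
have ks : (0 <= (2 * s)^-1)%R by rewrite invr_ge0 mulr_ge0// ltW.
have mg : measurable_fun [set: T] (fun t => (s * gain y (D t) (V t))%:E).
  by apply/measurable_EFinP; exact: measurable_funM.
have mv : measurable_fun [set: T] (fun t => (y / (2 * s) + (2 * s)^-1 * V t)%:E).
  by apply/measurable_EFinP; apply: measurable_funD => //; exact: measurable_funM.
have sg0 t : 0 <= (s * gain y (D t) (V t))%:E.
  by rewrite lee_fin mulr_ge0// ltW.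
have sv0 t : 0 <= (y / (2 * s) + (2 * s)^-1 * V t)%:E.
  by rewrite lee_fin addr_ge0// mulr_ge0.
apply: (@le_trans _ _ (\int[p]_t ((s * gain y (D t) (V t))%:E +
    (y / (2 * s) + (2 * s)^-1 * V t)%:E))).
  apply: ge0_le_integral => //.
  - exact: measurableT_comp.
  - exact: emeasurable_funD.
  - by move=> t _; rewrite -EFinD lee_fin abs_le_gain.
rewrite ge0_integralD// integral_affine// VW.
under eq_integral do rewrite EFinM.
rewrite ge0_integralZl//; last 3 first.
- exact/measurable_EFinP.
- by move=> t _; rewrite lee_fin.
- by rewrite lee_fin ltW.
apply: (@le_trans _ _ (s%:E * k%:E + ((y / (2 * s))%:E + (2 * s)^-1%:E * W%:E))).
  by apply: leeD2r; rewrite lee_wpmul2l// lee_fin ltW.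
rewrite -!EFinM -!EFinD lee_fin le_eqVlt; apply/orP; left; apply/eqP.
have -> : (s * k + (y / (2 * s) + (2 * s)^-1 * W) =
    r / 2 + (2 * (y + W) * k) / (2 * r))%R.
  by rewrite /s; field; rewrite !gt_eqF.
by rewrite -rr; field; rewrite gt_eqF.
Qed.

(** * Posteriors of mass 1, infinite values and Markov's inequality *)

(** The values of a probability kernel are typed as measures. Normalizing one of mass 1 leaves it
    unchanged and supplies the probability structure; [q] serves as the fallback that [mnormalize]
    asks for. *)
Lemma measure1_probability d (T : measurableType d) (R : realType)
    (q : probability T R) (m : {measure set T -> \bar R}) :
  m [set: T] = 1 ->
  exists p : probability T R, m = p :> {measure set T -> \bar R}.
Proof.
move=> m1; exists (mnormalize m q); apply: eq_measure; apply/funext => A /=.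
by rewrite /mnormalize m1 gt_eqF//= invr1 mule1.
Qed.

Lemma KL_ge0_measure d (T : measurableType d) (R : realType)
    (q : probability T R) (p : {measure set T -> \bar R}) :
  p [set: T] = 1 -> 0 <= KL p q.
Proof. by move=> /(measure1_probability q)[p' ->]; exact: KL_ge0. Qed.

(* [z |-> KL (phat z) p0] need not be measurable, so a high-probability event
   can only be cut out by the [q]-integral and the posterior mean of [V]: hence
   a deterministic bound with a condition on these. *)
Lemma pac_bayes d (T : measurableType d) (R : realType)
    (p : {measure set T -> \bar R}) (q : probability T R) (D V : T -> R)
    (y c1 c2 : R) (k : \bar R) :
  p [set: T] = 1 -> (0 < y)%R -> (forall t, 0 <= V t)%R ->
  measurable_fun [set: T] D -> measurable_fun [set: T] V ->
  (0 <= c1)%R -> (0 <= c2)%R ->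
  (expR c2)%:E * \int[q]_t (expR (gain y (D t) (V t) - cost y (V t)))%:E
    <= (expR c1)%:E ->
  \int[p]_t (V t)%:E < +oo ->
  0 < k ->
  (cost y (fine (\int[p]_t (V t)%:E)) + c1 - c2)%:E <= k ->
  `| \int[p]_t (D t)%:E | <=
    sqrte (2%:E * (y%:E + \int[p]_t (V t)%:E) * (KL p q + k)).
Proof.
move=> p1 y0 V0 mD mV c10 c20 q1 Vfin; have [p' pE] := measure1_probability q p1.
have V0' : 0 <= \int[p]_t (V t)%:E.
  by apply: integral_ge0 => t _; rewrite lee_fin.
have [W VW] : exists W, \int[p]_t (V t)%:E = W%:E.
  by exists (fine (\int[p]_t (V t)%:E)); rewrite fineK// ge0_fin_numE.
rewrite VW /= in V0' *; rewrite lee_fin in V0'.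
have m0 : (0 < 2 * (y + W))%R by rewrite mulr_gt0// ltr_pwDl.
rewrite {}pE in VW *; have := KL_ge0 p' q.
rewrite -!EFinD -EFinM.
(* If [KL] or [k] is infinite, the right-hand side is infinite, since [2 * (y + W) > 0]. *)
case: (KL p' q) (@pac_bayes_finite _ _ _ p' q D V y c1 c2) => [l| |]//.
  move=> H l0; case: k => [k| |]//; rewrite ?addey//.
    rewrite lee_fin in l0; rewrite -EFinD lte_fin lee_fin => k0 kc; rewrite -EFinM /=.
    by apply: H => //; rewrite -?EFinD ?lee_fin; lra.
  by move=> _ _; rewrite gt0_muley ?lte_fin// leey.
move=> _ _ _ ck; rewrite addye ?gt0_muley ?lte_fin ?leey//.
by rewrite gt_eqF// (lt_le_trans _ ck)// ltNyr.
Qed.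

Lemma markov_lt d (T : measurableType d) (R : realType) (P : probability T R)
    (X : T -> \bar R) (a b : R) :
  measurable_fun [set: T] X -> (forall t, 0 <= X t) -> (0 < a)%R ->
  \int[P]_t X t <= b%:E ->
  measurable [set t | X t < a%:E] /\
  (1 - b / a)%:E <= P [set t | X t < a%:E].
Proof.
move=> mX X0 a0 Xb.
have mE : measurable [set t | X t < a%:E].
  by rewrite -[X in measurable X]setTI; exact: emeasurable_fun_infty_o.
split=> //.
have := le_integral_abse P measurableT mX a0.
have -> : [set: T] `&` [set t | a%:E <= `|X t|] = ~` [set t | X t < a%:E].
  apply/seteqP; split => t /=.
    by move=> [_]; rewrite gee0_abs// => /le_gtF ->.
  by move=> /negP; rewrite -leNgt gee0_abs.
under eq_integral do rewrite gee0_abs//.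
move=> /le_trans/(_ Xb); have := probability_setC P mE => /= ->.
have : P [set t | X t < a%:E] \is a fin_num by exact: fin_num_measure.
case: (P _) => // r _; rewrite -EFinB -EFinM !lee_fin => h.
by rewrite lerBlDr -lerBlDl ler_pdivlMr// mulrC.
Qed.

(** * The random sample and the two high-probability events *)

Unset Implicit Arguments.

Theorem theorem3 (R : realType)
  (dO : measure_display) (Omega : measurableType dO) (P : probability Omega R)
  (dT : measure_display) (Th : measurableType dT)
  (dZ : measure_display) (Z : measurableType dZ)
  (S : Omega -> Z) (mS : measurable_fun [set: Omega] S)
  (Delta V : Th * Z -> R)
  (mDelta : measurable_fun [set: Th * Z] Delta)
  (mV : measurable_fun [set: Th * Z] V)
  (V_ge0 : forall u, (0 <= V u)%R)
  (canon : forall t : Th,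
     canonical_pair P (fun w => Delta (t, S w)) (fun w => Num.sqrt (V (t, S w))))
  (phat : R.-pker Z ~> Th) (p0 : probability Th R)
  (theta : Omega -> Th) (mtheta : measurable_fun [set: Omega] theta)
  (theta_cond : forall (A : set Z) (B : set Th), measurable A -> measurable B ->
     P (S @^-1` A `&` theta @^-1` B) = \int[P]_(w in S @^-1` A) phat (S w) B)
  (integ : {ae P, forall w, \int[phat (S w)]_t (`|Delta (t, S w)|)%:E < +oo}) :
  let EDS := fun w => cexpk phat Delta (S w) in
  let EVS := fun w => cexpk phat V (S w) in
  let EV := \int[P]_w EVS w in
  (* (i) *)
  ((0 < EV < +oo) -> forall x : R, (0 <= x)%R ->
    exists E : set Omega, [/\ measurable E,
      E `<=` [set w | `| EDS w | <=
         sqrte (2%:E * (EV + EVS w) * (KL (phat (S w)) p0 + (2 * x)%:E))] &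
      ((1 - 2 * expR (- x))%:E <= P E)]) /\
  (* (ii) *)
  (forall y x : R, (0 < y)%R -> (2 <= x)%R ->
    exists E : set Omega, [/\ measurable E,
      E `<=` [set w | `| EDS w | <=
         sqrte (2%:E * (y%:E + EVS w) *
                (KL (phat (S w)) p0 + x%:E +
                 (x / 2)%:E * eln (1 + (y^-1)%:E * EVS w)))] &
      ((1 - expR (- x))%:E <= P E)]).
Proof.
move=> EDS EVS EV.
have mDS t : measurable_fun [set: Omega] (fun w => Delta (t, S w)).
  by apply: measurableT_comp => //; exact: measurableT_comp.
have mVS t : measurable_fun [set: Omega] (fun w => V (t, S w)).
  by apply: measurableT_comp => //; exact: measurableT_comp.
have mDt w : measurable_fun [set: Th] (fun t => Delta (t, S w)).
  exact: measurableT_comp.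
have mVt w : measurable_fun [set: Th] (fun t => V (t, S w)).
  exact: measurableT_comp.
have phat1 w : phat (S w) [set: Th] = 1 by exact: prob_kernel.
have mEVS : measurable_fun [set: Omega] EVS.
  have mk : measurable_fun [set: Z * Th] (fun u => (V (u.2, u.1))%:E).
    apply/measurable_EFinP; apply: measurableT_comp => //.
    exact: measurable_fun_pair.
  have k0 (u : Z * Th) : 0 <= (V (u.2, u.1))%:E by rewrite lee_fin.
  exact: (measurableT_comp
    (measurable_fun_integral_finite_kernel _ phat k0 mk) mS).
have EVS0 w : 0 <= EVS w by apply: integral_ge0 => t _; rewrite lee_fin.
pose F y (u : Omega * Th) :=
  (expR (gain y (Delta (u.2, S u.1)) (V (u.2, S u.1)) -
    cost y (V (u.2, S u.1))))%:E.
have F0 y u : 0 <= F y u by rewrite lee_fin expR_ge0.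
pose G y w := \int[p0]_t F y (w, t).
have G0 y w : 0 <= G y w by apply: integral_ge0.
have mF y : (0 < y)%R -> measurable_fun [set: Omega * Th] (F y).
  move=> y0.
  have mu : measurable_fun [set: Omega * Th] (fun u => (u.2, S u.1)).
    by apply: measurable_fun_pair => //; exact: measurableT_comp.
  apply/measurable_EFinP; apply: measurableT_comp => //.
  apply: measurable_funB.
    by apply: measurable_gain => //; exact: measurableT_comp.
  by apply: measurable_cost; exact: measurableT_comp.
have mG y : (0 < y)%R -> measurable_fun [set: Omega] (G y).
  by move=> y0; exact: (@measurable_fun_fubini_tonelli_F _ _ _ _ _ p0 _ (mF y y0) (F0 y)).
(* After Tonelli the inner mean over [P] is at most 1 for each fixed [t], by the canonical-pair
   hypothesis, and [p0] has mass 1. *)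
have G1 y : (0 < y)%R -> \int[P]_w G y w <= 1.
  move=> y0; rewrite (@fubini_tonelli _ _ _ _ _ P p0 _ (mF y y0) (F0 y)).
  have p01 : \int[p0]__ 1 <= 1.
    rewrite [leLHS](integral_cst p0 measurableT 1) mul1e.
    exact: probability_le1.
  apply: le_trans p01.
  apply: ge0_le_integral => //.
  - by move=> t _; apply: integral_ge0 => w _; exact: F0.
  - exact: (@measurable_fun_fubini_tonelli_G _ _ _ _ _ P _ (mF y y0) (F0 y)).
  - move=> t _; apply: (gaussian_mixture y0 (fun w => V_ge0 _) (mDS t) (mVS t)) => l.
    have [_ canon_t] := canon t.
    apply: le_trans canon_t; apply: ereal_sup_ubound; exists l => //.
    by apply: eq_integral => w _; rewrite sqr_sqrtr.
split.
- move=> /andP[EV0 EVoo] x x0.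
  (* At [x = 0] the claimed probability is -1 and the empty event will do; [pac_bayes] is applied
     with the positive [k = 2x]. *)
  have [xpos|xle0] := ltP 0%R x; last first.
    exists set0; split => //.
    have -> : x = 0%R by apply/eqP; rewrite eq_le xle0 x0.
    by rewrite oppr0 expR0 measure0 lee_fin; lra.
  pose y := fine EV.
  have yE : EV = y%:E by rewrite fineK// ge0_fin_numE// ltW.
  have y0 : (0 < y)%R by rewrite -lte_fin -yE.
  (* Summing the two quantities lets a single use of Markov's inequality control both. *)
  pose X w := G y w + (1 + y^-1%:E * EVS w).
  have yV0 : (0 <= y^-1)%R by rewrite invr_ge0 ltW.
  have u0 w : 0 <= y^-1%:E * EVS w by rewrite mule_ge0.
  have mu : measurable_fun [set: Omega] (fun w => y^-1%:E * EVS w).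
    exact: measurable_funeM.
  have X0 w : 0 <= X w by rewrite adde_ge0// adde_ge0.
  have mX : measurable_fun [set: Omega] X.
    by apply: emeasurable_funD; [exact: mG|exact: emeasurable_funD].
  have X3 : \int[P]_w X w <= 3%:E.
    rewrite ge0_integralD//; first last.
    - exact: emeasurable_funD.
    - by move=> w _; rewrite adde_ge0.
    - exact: mG.
    have Iu : \int[P]_w (y^-1%:E * EVS w) = 1.
      by rewrite ge0_integralZl// -/EV yE -EFinM mulVf ?gt_eqF.
    have -> : \int[P]_w (1 + y^-1%:E * EVS w) = \int[P]__ 1 + 1.
      by rewrite ge0_integralD// Iu.
    rewrite (_ : 3%:E = 1 + (1 + 1)); last by rewrite -!EFinD; congr EFin; ring.
    apply: leeD; first exact: G1.
    apply: leeD => //.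
    rewrite [leLHS](integral_cst P measurableT 1) mul1e.
    exact: probability_le1.
  (* The failure probability is at most [3 / (2 e^x)], which is below [2 e^(-x)]. *)
  have a0 : (0 < 2 * expR x)%R by rewrite mulr_gt0// expR_gt0.
  have [mE PE] := markov_lt mX X0 a0 X3.
  exists [set w | X w < (2 * expR x)%:E]; split => //; last first.
    apply: le_trans PE; rewrite lee_fin expRN.
    have : (0 < (expR x)^-1)%R by rewrite invr_gt0 expR_gt0.
    rewrite invfM; lra.
  move=> w /= Xw.
  have W_fin : EVS w < +oo.
    rewrite ltey; apply/negP => /eqP WE; move: Xw.
    rewrite /X WE gt0_muley ?lte_fin ?invr_gt0// !addey// ?gt_eqF//.
    by rewrite (lt_le_trans _ (G0 y w))// ltNyr.
  have Gfin : G y w \is a fin_num.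
    rewrite ge0_fin_numE//; apply: le_lt_trans (lt_trans Xw (ltry _)).
    by rewrite leeDl// adde_ge0.
  have [W EW] : exists W, EVS w = W%:E.
    by exists (fine (EVS w)); rewrite fineK// ge0_fin_numE.
  have [g Gg] : exists g, G y w = g%:E by exists (fine (G y w)); rewrite fineK.
  have W0 : (0 <= W)%R by rewrite -lee_fin -EW.
  have g0 : (0 <= g)%R by rewrite -lee_fin -Gg.
  pose u := (1 + W / y)%R; have u1 : (1 <= u)%R by rewrite lerDl divr_ge0// ltW.
  have u_gt0 : (0 < u)%R by apply: lt_le_trans u1.
  have lnu0 : (0 <= ln u)%R by exact: ln_ge0.
  have gu : (g + u < 2 * expR x)%R.
    move: Xw; rewrite /X Gg EW -EFinM -!EFinD lte_fin /u.
    by rewrite [(W / y)%R]mulrC.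
  rewrite yE /EDS /cexpk.
  (* Here [k = c1 = 2x], and [c2 = ln u] outweighs the cost [ln u / 2]. The required
     [u * g <= e^(2x)] follows from [4 g u = (g + u)^2 - (g - u)^2]. *)
  apply: (@pac_bayes _ _ _ _ _ _ _ _ (2 * x) (ln u)) => //.
  - by rewrite mulr_ge0.
  - rewrite -/(G y w) Gg lnK// -EFinM lee_fin expRM_natl.
    rewrite -subr_ge0; have : (g + u <= 2 * expR x)%R by exact: ltW.
    have := sqr_ge0 (g - u); have := expR_gt0 x; nra.
  - by rewrite lte_fin mulr_gt0.
  - rewrite -/(cexpk phat V (S w)) -/(EVS w) EW /= /cost -/u lee_fin; lra.
- move=> y x y0 x2.
  have [mE PE] := markov_lt (mG y y0) (G0 y) (expR_gt0 x) (G1 y y0).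
  exists [set w | G y w < (expR x)%:E]; split => //; last first.
    by rewrite expRN -[X in (1 - X)%R]mul1r.
  move=> w /= Gw.
  have x0 : (0 < x)%R by lra.
  have KL0 : 0 <= KL (phat (S w)) p0 by exact: KL_ge0_measure.
  (* An infinite posterior mean of [V] makes the right-hand side infinite. *)
  have [WE|Wfin] := eqVneq (EVS w) +oo.
    have yV0 : (0 < y^-1)%R by rewrite invr_gt0.
    have x20 : (0 < x / 2)%R by rewrite divr_gt0.
    have KLx : KL (phat (S w)) p0 + x%:E != -oo.
      by rewrite gt_eqF// (lt_le_trans (ltNyr 0))// adde_ge0// lee_fin ltW.
    rewrite WE !gt0_muley ?lte_fin//.
    by rewrite addey// gt0_muley ?leey// ltry.
  have [W EW] : exists W, EVS w = W%:E.
    by exists (fine (EVS w)); rewrite fineK// ge0_fin_numE// ltey.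
  have W0 : (0 <= W)%R by rewrite -lee_fin -EW.
  have lnu0 : (0 <= ln (1 + W / y))%R.
    by rewrite ln_ge0// lerDl divr_ge0// ltW.
  have kE : x%:E + (x / 2)%:E * eln (1 + (y^-1)%:E * EVS w) =
      (x + x / 2 * ln (1 + W / y))%:E.
    by rewrite EW -EFinM -EFinD /= [(y^-1 * W)%R]mulrC.
  rewrite -addeA kE /EDS /EVS /cexpk.
  (* With [c1 = x] and [c2 = 0], the cost [ln (1 + W / y) / 2] is covered by
     [x / 2 * ln (1 + W / y)] because [x >= 2]. *)
  apply: (@pac_bayes _ _ _ _ _ _ _ _ x 0) => //.
  - by rewrite ltW.
  - by rewrite expR0 mul1e ltW.
  - by rewrite -/(cexpk phat V (S w)) -/(EVS w) EW ltry.
  - by rewrite lte_fin ltr_wpDr// mulr_ge0// divr_ge0// ltW.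
  - rewrite -/(cexpk phat V (S w)) -/(EVS w) EW /= /cost subr0 lee_fin; nra.
Qed.
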